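(* In the setting described in the context, fix $x^*\in X^*$, choose an initial point $x_0$, target accuracy $0<\epsilon\leq2\|x_0-x^*\|_L^2$, confidence $0<\rho<1$, and $$k\geq\frac{4n\|x_0-x^*\|_L^2}{\epsilon}\log\left(\frac{2(F(x_0)-F^* )}{\rho\epsilon}\right).$$ Let $F_\mu(x)=F(x)+\frac\mu2\|x-x_0\|_L^2$ with $\mu=\frac{\epsilon}{\|x_0-x^*\|_L^2}$, viewed as the composite function $f+\Psi_\mu$ with $\Psi_\mu(x)=\Psi(x)+\frac\mu2\|x-x_0\|_L^2$. If $x_k$ is the random point generated by UCDC$(x_0)$ applied to $F_\mu$, then $\mathbf{P}(F(x_k)-F^*\leq\epsilon)\geq1-\rho$.
   Context: Let $U\in\mathbf{R}^{N\times N}$ be a column permutation of the $N\times N$ identity matrix, partitioned as $U=[U_1,\dots,U_n]$ with $U_i\in\mathbf{R}^{N\times N_i}$, $\sum_iN_i=N$. For $x\in\mathbf{R}^N$ write $x^{(i)}=U_i^Tx$. Each $\mathbf{R}^{N_i}$ carries the norm $\|t\|_{(i)}=\langle B_it,t\rangle^{1/2}$ and dual norm $\|t\|_{(i)}^*=\langle B_i^{-1}t,t\rangle^{1/2}$ with $B_i$ positive definite. Consider $F(x)=f(x)+\Psi(x)$ on $\mathbf{R}^N$, where $f$ is convex and differentiable with $\|\nabla_if(x+U_it)-\nabla_if(x)\|_{(i)}^*\leq L_i\|t\|_{(i)}$ for all $x,t,i$ (constants $L_i>0$, $\nabla_if(x)=U_i^T\nabla f(x)$), and $\Psi(x)=\sum_i\Psi_i(x^{(i)})$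 with each $\Psi_i$ proper closed convex. $F$ has a minimizer; $F^*$ is the minimum value and $X^*$ the set of minimizers. $\|x\|_L=(\sum_iL_i\|x^{(i)}\|_{(i)}^2)^{1/2}$. For a composite function $f+\Phi$ with $\Phi(x)=\sum_i\Phi_i(x^{(i)})$ block separable, UCDC$(x_0)$ is: for $k=0,1,2,\dots$, choose $i\in\{1,\dots,n\}$ uniformly at random (independently), compute $T^{(i)}(x_k)=\arg\min_{t\in\mathbf{R}^{N_i}}\{\langle\nabla_if(x_k),t\rangle+\frac{L_i}{2}\|t\|_{(i)}^2+\Phi_i(x_k^{(i)}+t)\}$ and set $x_{k+1}=x_k+U_iT^{(i)}(x_k)$. *)

(* Defs.v *)
From HB Require Import structures.
From mathcomp Require Import all_boot all_order all_algebra.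
From mathcomp Require Import all_classical all_reals all_analysis.
Set Implicit Arguments. Unset Strict Implicit. Unset Printing Implicit Defensive.
Import Order.TTheory GRing.Theory Num.Theory.
Import numFieldNormedType.Exports.
Local Open Scope ring_scope.
Local Open Scope classical_set_scope.

Section Defs.
Context {R : realType}.

Definition dotv m (a b : 'cV[R]_m) : R := (a^T *m b) 0 0.

Definition blk_norm m (B : 'M[R]_m) (t : 'cV[R]_m) : R := Num.sqrt (dotv (B *m t) t).
Definition dual_norm m (B : 'M[R]_m) (t : 'cV[R]_m) : R :=
  Num.sqrt (dotv (invmx B *m t) t).

Definition posdef m (B : 'M[R]_m) : Prop :=
  B^T = B /\ forall t : 'cV[R]_m, t != 0 -> 0 < dotv (B *m t) t.

(* [U_1, ..., U_n] is a column permutation of the N x N identity matrix: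
   0/1 entries, exactly one 1 in every column, exactly one 1 in every row *)
Definition col_perm_blocks N n (Ns : 'I_n -> nat)
  (U : forall i : 'I_n, 'M[R]_(N, Ns i)) : Prop :=
  (forall i r c, U i r c = 0 \/ U i r c = 1) /\
  (forall i (c : 'I_(Ns i)), exists! r : 'I_N, U i r c = 1) /\
  (forall r : 'I_N, exists! ic : {i : 'I_n & 'I_(Ns i)},
       U (projT1 ic) r (projT2 ic) = 1).

Definition grad N (f : 'cV[R]_N -> R) (x : 'cV[R]_N) : 'cV[R]_N :=
  \col_j ('D_(delta_mx j 0) f x).

Definition convex_fun N (f : 'cV[R]_N -> R) : Prop :=
  forall x y (a : R), 0 <= a <= 1 ->
    f (a *: x + (1 - a) *: y) <= a * f x + (1 - a) * f y.

Definition proper_fun m (g : 'cV[R]_m -> \bar R) : Prop :=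
  (forall t, g t != -oo%E) /\ exists t, g t \is a fin_num.
Definition ext_convex m (g : 'cV[R]_m -> \bar R) : Prop :=
  forall (t s : 'cV[R]_m) (a : R), 0 < a < 1 ->
    (g ((a *: t + (1 - a) *: s)%R) <= a%:E * g t + (1 - a)%:E * g s)%E.
Definition closed_fun m (g : 'cV[R]_m -> \bar R) : Prop :=
  closed [set p : 'cV[R]_m * R | (g p.1 <= p.2%:E)%E].

Definition Psi_sum N n (Ns : 'I_n -> nat) (U : forall i : 'I_n, 'M[R]_(N, Ns i))
  (Psi : forall i : 'I_n, 'cV[R]_(Ns i) -> \bar R) (x : 'cV[R]_N) : \bar R :=
  (\sum_(i < n) Psi i ((U i)^T *m x))%E.
Definition Fcomp N n (Ns : 'I_n -> nat) (U : forall i : 'I_n, 'M[R]_(N, Ns i))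
  (f : 'cV[R]_N -> R) (Psi : forall i : 'I_n, 'cV[R]_(Ns i) -> \bar R)
  (x : 'cV[R]_N) : \bar R :=
  ((f x)%:E + Psi_sum U Psi x)%E.

Definition Lnorm2 N n (Ns : 'I_n -> nat) (U : forall i : 'I_n, 'M[R]_(N, Ns i))
  (B : forall i : 'I_n, 'M[R]_(Ns i)) (L : 'I_n -> R) (x : 'cV[R]_N) : R :=
  \sum_(i < n) L i * blk_norm (B i) ((U i)^T *m x) ^+ 2.

(* a minimizer (chosen; the minimizer is unique in the UCDC use) *)
Definition argmin m (h : 'cV[R]_m -> \bar R) : 'cV[R]_m :=
  xget 0 [set t | forall s, (h t <= h s)%E].

Definition ucdc_T N n (Ns : 'I_n -> nat) (U : forall i : 'I_n, 'M[R]_(N, Ns i))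
  (B : forall i : 'I_n, 'M[R]_(Ns i)) (L : 'I_n -> R) (f : 'cV[R]_N -> R)
  (Phi : forall i : 'I_n, 'cV[R]_(Ns i) -> \bar R) (x : 'cV[R]_N) (i : 'I_n)
  : 'cV[R]_(Ns i) :=
  argmin (fun t => ((dotv ((U i)^T *m grad f x) t
                     + L i / 2 * blk_norm (B i) t ^+ 2)%:E
                    + Phi i (((U i)^T *m x + t)%R))%E).

Definition ucdc N n (Ns : 'I_n -> nat) (U : forall i : 'I_n, 'M[R]_(N, Ns i))
  (B : forall i : 'I_n, 'M[R]_(Ns i)) (L : 'I_n -> R) (f : 'cV[R]_N -> R)
  (Phi : forall i : 'I_n, 'cV[R]_(Ns i) -> \bar R) (x0 : 'cV[R]_N)
  (s : seq 'I_n) : 'cV[R]_N :=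
  foldl (fun x i => x + U i *m ucdc_T U B L f Phi x i) x0 s.

(* probability, under i.i.d. uniform block choices i_0..i_{k-1}, that the
   k-th UCDC iterate satisfies P *)
Definition ucdc_prob N n (Ns : 'I_n -> nat) (U : forall i : 'I_n, 'M[R]_(N, Ns i))
  (B : forall i : 'I_n, 'M[R]_(Ns i)) (L : 'I_n -> R) (f : 'cV[R]_N -> R)
  (Phi : forall i : 'I_n, 'cV[R]_(Ns i) -> \bar R) (x0 : 'cV[R]_N) (k : nat)
  (P : pred 'cV[R]_N) : R :=
  #|[set s : k.-tuple 'I_n | P (ucdc U B L f Phi x0 s)]|%:R
    / #|{: k.-tuple 'I_n}|%:R.

End Defs.

(* Main.v *)
Require Import Defs.
From HB Require Import structures.
From mathcomp Require Import all_boot all_order all_algebra.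
From mathcomp Require Import all_classical all_reals all_analysis.
From mathcomp Require Import ring lra.
Set Implicit Arguments. Unset Strict Implicit. Unset Printing Implicit Defensive.
Import Order.TTheory GRing.Theory Num.Theory.
Import numFieldNormedType.Exports.
Local Open Scope ring_scope.

(** Write F_mu = f + Psi_mu and a = mu / (1 + mu).  By the block Lipschitz
    condition, the model minimized in block i majorizes f along that block.
    Comparing the minimizer with the trial point a (y - x)^(i), and using that
    Psi_mu is mu-strongly convex for the norm |.|_L, gives for every y in the
    domain
      sum_i (F_mu(x + U_i T^(i)(x)) - F_mu(x)) <= a (F_mu(y) - F_mu(x)),
    so the expected gap to inf F_mu shrinks by the factor 1 - a/n per step, and
    no minimizer of F_mu is needed.  Since mu <= 2 forces a >= mu/4, the bound
    on k brings the expected gap below rho eps / 2; Markov's inequality then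
    gives a gap at most eps / 2 with probability at least 1 - rho, and
    inf F_mu <= F_mu(xstar) = F^* + eps / 2. *)

(** * Inner products and the norms given by a positive definite matrix *)

Section QuadraticForms.
Context {R : realType}.

Lemma dotvE m (a b : 'cV[R]_m) : dotv a b = \sum_j a j 0 * b j 0.
Proof. by rewrite /dotv mxE; apply: eq_bigr => j _; rewrite mxE. Qed.

Lemma dotvC m (a b : 'cV[R]_m) : dotv a b = dotv b a.
Proof. by rewrite !dotvE; apply: eq_bigr => j _; rewrite mulrC. Qed.

Lemma dotvDl m (a b c : 'cV[R]_m) : dotv (a + b) c = dotv a c + dotv b c.
Proof. by rewrite /dotv linearD mulmxDl mxE. Qed.

Lemma dotvZl m (k : R) (a b : 'cV[R]_m) : dotv (k *: a) b = k * dotv a b.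
Proof. by rewrite /dotv linearZ -scalemxAl mxE. Qed.

Lemma dotvDr m (a b c : 'cV[R]_m) : dotv a (b + c) = dotv a b + dotv a c.
Proof. by rewrite dotvC dotvDl !(dotvC a). Qed.

Lemma dotvZr m (k : R) (a b : 'cV[R]_m) : dotv a (k *: b) = k * dotv a b.
Proof. by rewrite dotvC dotvZl dotvC. Qed.

Lemma dotvNl m (a b : 'cV[R]_m) : dotv (- a) b = - dotv a b.
Proof. by rewrite -scaleN1r dotvZl mulN1r. Qed.

Lemma dotvNr m (a b : 'cV[R]_m) : dotv a (- b) = - dotv a b.
Proof. by rewrite -scaleN1r dotvZr mulN1r. Qed.

Lemma dotv0 m (a : 'cV[R]_m) : dotv a 0 = 0.
Proof. by rewrite /dotv mulmx0 mxE. Qed.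

Lemma dotv_mulmxl p m (A : 'M[R]_(p, m)) a b : dotv (A *m a) b = dotv a (A^T *m b).
Proof. by rewrite /dotv trmx_mul mulmxA. Qed.

Lemma dotv_delta m (j : 'I_m) (a : 'cV[R]_m) : dotv (delta_mx j 0) a = a j 0.
Proof.
rewrite dotvE (bigD1 j) //= mxE !eqxx mul1r big1 ?addr0 // => l lj.
by rewrite mxE (negbTE lj) mul0r.
Qed.

Context {m : nat} {B : 'M[R]_m} (hB : posdef B).
Implicit Types (a t s : 'cV[R]_m).

Lemma posdef_ge0 t : 0 <= dotv (B *m t) t.
Proof.
have [->|t0] := eqVneq t 0; first by rewrite dotv0.
by rewrite ltW // hB.2.
Qed.

Lemma posdef_dotvC t s : dotv (B *m t) s = dotv (B *m s) t.
Proof. by rewrite dotv_mulmxl hB.1 dotvC. Qed.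

Lemma blk_norm_ge0 t : 0 <= blk_norm B t.
Proof. exact: sqrtr_ge0. Qed.

Lemma blk_norm_sqr t : blk_norm B t ^+ 2 = dotv (B *m t) t.
Proof. by rewrite /blk_norm sqr_sqrtr // posdef_ge0. Qed.

Lemma blk_norm_sqrD t s :
  blk_norm B (t + s) ^+ 2 = blk_norm B t ^+ 2 + 2 * dotv (B *m t) s + blk_norm B s ^+ 2.
Proof.
rewrite !blk_norm_sqr mulmxDr !(dotvDl, dotvDr) (posdef_dotvC s t); ring.
Qed.

Lemma blk_norm_sqrZ k t : blk_norm B (k *: t) ^+ 2 = k ^+ 2 * blk_norm B t ^+ 2.
Proof. by rewrite !blk_norm_sqr -scalemxAr dotvZl dotvZr; ring. Qed.

Lemma blk_norm_sqrB t s :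
  blk_norm B (t - s) ^+ 2 = blk_norm B t ^+ 2 - 2 * dotv (B *m s) t + blk_norm B s ^+ 2.
Proof.
rewrite blk_norm_sqrD -(scaleN1r s) blk_norm_sqrZ dotvZr (posdef_dotvC s); ring.
Qed.

Lemma blk_normZ k t : 0 <= k -> blk_norm B (k *: t) = k * blk_norm B t.
Proof.
move=> k0; apply/eqP; rewrite -(@eqrXn2 _ 2) ?mulr_ge0 ?blk_norm_ge0 //.
by rewrite blk_norm_sqrZ exprMn.
Qed.

(** The exact convexity defect of the squared norm; its last term is the strong convexity gain of
    the regularizer. *)
Lemma blk_norm_sqr_conv (l : R) t s :
  blk_norm B ((1 - l) *: t + l *: s) ^+ 2 =
  (1 - l) * blk_norm B t ^+ 2 + l * blk_norm B s ^+ 2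
  - l * (1 - l) * blk_norm B (s - t) ^+ 2.
Proof.
rewrite !blk_norm_sqrD -(scaleN1r t) !blk_norm_sqrZ -!scalemxAr !dotvZl !dotvZr.
by rewrite (posdef_dotvC s t); ring.
Qed.

(** A nonzero row v with v B = 0 would, by symmetry of [B], make the form vanish at the transpose of
    v. *)
Lemma posdef_unitmx : B \in unitmx.
Proof.
rewrite -row_free_unit -kermx_eq0; apply/eqP/row_matrixP => j; rewrite row0.
have kB : row j (kermx B) *m B = 0.
  by apply/sub_kermxP; rewrite row_sub.
apply/trmx_inj; rewrite trmx0; apply/eqP/negP => /negP v0.
have := hB.2 _ v0; rewrite -{1}hB.1 -trmx_mul kB trmx0 dotvC dotv0 ltxx //.
Qed.

Lemma posdef_cauchy_schwarz t s :
  dotv (B *m t) s ^+ 2 <= blk_norm B t ^+ 2 * blk_norm B s ^+ 2.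
Proof.
have [->|s0] := eqVneq s 0.
  by rewrite dotv0 expr0n /= mulr_ge0 // sqr_ge0.
have p : 0 < blk_norm B s ^+ 2 by rewrite blk_norm_sqr hB.2.
(* With p the squared norm of [s], this square expands to p times the difference of the two sides of
   the claim. *)
have := sqr_ge0 (blk_norm B (blk_norm B s ^+ 2 *: t + - dotv (B *m t) s *: s)).
rewrite blk_norm_sqrD !blk_norm_sqrZ -scalemxAr dotvZl dotvZr => h.
rewrite -(ler_pM2l p) -subr_ge0; apply: le_trans h _.
by rewrite le_eqVlt; apply/orP; left; apply/eqP; ring.
Qed.

(** The dual norm of [a] is the primal norm of [invmx B *m a], so this is Cauchy-Schwarz for that
    vector and [t]. *)
Lemma dotv_le_dual_norm a t : dotv a t <= dual_norm B a * blk_norm B t.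
Proof.
have aE : B *m (invmx B *m a) = a by rewrite mulmxA mulmxV ?mul1mx // posdef_unitmx.
have -> : dual_norm B a = blk_norm B (invmx B *m a).
  by rewrite /dual_norm /blk_norm aE dotvC.
rewrite -{1}aE.
have [h|/ltW h] := lerP (dotv (B *m (invmx B *m a)) t) 0.
  by rewrite (le_trans h) // mulr_ge0 // blk_norm_ge0.
rewrite -(@ler_pXn2r _ 2) ?nnegrE ?mulr_ge0 ?blk_norm_ge0 //.
by rewrite exprMn posdef_cauchy_schwarz.
Qed.

End QuadraticForms.

(** * Orthogonality and completeness of the column blocks *)

Section BlockPermutation.
Context {R : realType} {N n : nat} {Ns : 'I_n -> nat}.
Context {U : forall i : 'I_n, 'M[R]_(N, Ns i)} (hU : col_perm_blocks U).

Lemma block_trmx_mul (i : 'I_n) : (U i)^T *m U i = 1%:M.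
Proof.
have [h01 [hc hr]] := hU; apply/matrixP => c d; rewrite !mxE.
have [<-|cd] := eqVneq c d.
  have [r [r1 ru]] := hc i c; rewrite (bigD1 r) //= mxE r1 mulr1 big1 ?addr0 // => q qr.
  rewrite mxE; have [->|q1] := h01 i q c; first by rewrite mul0r.
  by rewrite (ru _ q1) eqxx in qr.
rewrite big1 // => r _; rewrite mxE.
have [->|p1] := h01 i r c; first by rewrite mul0r.
have [->|q1] := h01 i r d; first by rewrite mulr0.
have [w [_ wu]] := hr r.
(* Both pairs are the unique position of the 1 in row [r]; [tagged_asE] extracts c = d from the
   equality of dependent pairs. *)
have := etrans (esym (wu (existT _ i c) p1)) (wu (existT _ i d) q1).
move/eqP; rewrite -tag_eqE /tag_eq /= eqxx tagged_asE (negbTE cd) //.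
Qed.

Lemma block_trmx_mul0 (i j : 'I_n) : i != j -> (U i)^T *m U j = 0.
Proof.
have [h01 [hc hr]] := hU; move=> ij; apply/matrixP => c d; rewrite !mxE.
rewrite big1 // => r _; rewrite mxE.
have [->|p1] := h01 i r c; first by rewrite mul0r.
have [->|q1] := h01 j r d; first by rewrite mulr0.
have [w [_ wu]] := hr r.
have := etrans (esym (wu (existT _ i c) p1)) (wu (existT _ j d) q1).
by move/(congr1 (@projT1 _ _)) => /= e; rewrite e eqxx in ij.
Qed.

(** The double sum is flattened over pairs (block, column): row [r] has its 1 at a single pair, and
    no column has a 1 in two distinct rows. *)
Lemma block_sum_mul_trmx : \sum_i U i *m (U i)^T = 1%:M.
Proof.
have [h01 [hc hr]] := hU; apply/matrixP => r q; rewrite summxE !mxE.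
under eq_bigr => i _ do rewrite mxE.
rewrite (sig_big_dep (fun=> true) (fun=> xpredT) (fun i c => U i r c * (U i)^T c q)) /=.
have [[i c] [ic1 icu]] := hr r; rewrite /= in ic1.
have [<-|rq] := eqVneq r q.
  rewrite (bigD1 (Tagged _ c)) //= mxE ic1 mulr1 big1 ?addr0 // => -[j d] ne /=.
  rewrite mxE; have [->|q1] := h01 j r d; first by rewrite mul0r.
  by rewrite -(icu (existT _ j d) q1) eqxx in ne.
rewrite big1 // => -[j d] _ /=; rewrite mxE.
have [->|p1] := h01 j r d; first by rewrite mul0r.
have [->|q1] := h01 j q d; first by rewrite mulr0.
have [w [_ wu]] := hc j d.
by rewrite -(wu _ p1) -(wu _ q1) eqxx in rq.
Qed.

Lemma block_proj_step (i j : 'I_n) (x : 'cV[R]_N) (t : 'cV[R]_(Ns i)) :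
  i != j -> (U j)^T *m (x + U i *m t) = (U j)^T *m x.
Proof.
by move=> ij; rewrite mulmxDr mulmxA block_trmx_mul0 1?eq_sym // mul0mx addr0.
Qed.

Lemma block_proj_step_same (i : 'I_n) (x : 'cV[R]_N) (t : 'cV[R]_(Ns i)) :
  (U i)^T *m (x + U i *m t) = (U i)^T *m x + t.
Proof. by rewrite mulmxDr mulmxA block_trmx_mul mul1mx. Qed.

Lemma block_sum_step (G : forall j : 'I_n, 'cV[R]_(Ns j) -> R) (i : 'I_n)
    (x : 'cV[R]_N) (t : 'cV[R]_(Ns i)) :
  \sum_j G j ((U j)^T *m (x + U i *m t)) =
  \sum_j G j ((U j)^T *m x) + (G i ((U i)^T *m x + t) - G i ((U i)^T *m x)).
Proof.
rewrite (bigD1 i) //= block_proj_step_same [in RHS](bigD1 i) //=.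
rewrite (eq_bigr (fun j => G j ((U j)^T *m x))); first by ring.
by move=> j ji; rewrite block_proj_step // eq_sym.
Qed.

Lemma dotv_block_sum (a b : 'cV[R]_N) :
  dotv a b = \sum_i dotv ((U i)^T *m a) ((U i)^T *m b).
Proof.
under eq_bigr => i _ do rewrite dotv_mulmxl trmxK.
rewrite -{1}(mul1mx b) -block_sum_mul_trmx mulmx_suml /dotv mulmx_sumr summxE.
by apply: eq_bigr => i _; rewrite !mulmxA.
Qed.

End BlockPermutation.

(** * First-order bounds from convexity and from gradient growth *)

Section GradientBounds.
Local Open Scope classical_set_scope.
Context {R : realType} {N : nat} {f : 'cV[R]_N -> R}.
Context (hf : forall x, differentiable f x).

Lemma derive_dotv_grad x v : 'D_v f x = dotv (grad f x) v.
Proof.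
rewrite deriveE // {1}(matrix_sum_delta v) linear_sum dotvE.
apply: eq_bigr => j _; rewrite big_ord1 linearZ /= mxE deriveE //.
by rewrite mulrC.
Qed.

Lemma is_derive_line (x v : 'cV[R]_N) (s : R) :
  is_derive s 1 (fun r : R => f (x + r *: v)) (dotv (grad f (x + s *: v)) v).
Proof.
have e : (fun h : R => h^-1 *: (f (x + (h *: 1 + s) *: v) - f (x + s *: v))) =
         (fun h : R => h^-1 *: (f (h *: v + (x + s *: v)) - f (x + s *: v))).
  apply/funext => h; congr (_ *: (f _ - _)).
  by rewrite scaler1 scalerDl addrCA.
have d := @diff_derivable _ _ _ f (x + s *: v) v (hf _).
split; first by rewrite /derivable /= e.
by rewrite -derive_dotv_grad /derive /= e.
Qed.

Lemma convex_grad_le x y : convex_fun f -> f x + dotv (grad f x) (y - x) <= f y.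
Proof.
move=> cf; rewrite -lerBrDl -derive_dotv_grad.
have := @diff_derivable _ _ _ f x (y - x) (hf _).
rewrite /derivable => /cvg_ex[l hl].
have -> : 'D_(y - x) f x = l by exact: (cvg_lim _ hl).
(* Convexity bounds the difference quotient by f y - f x only for 0 < h <= 1, so the limit is taken
   from the right. *)
have hr : (fun h : R => h^-1 *: (f (h *: (y - x) + x) - f x)) @ (0 : R)^'+ --> l.
  apply: cvg_trans hl; apply: cvg_app; apply: within_subset => z /=.
  by rewrite lt_neqAle eq_sym => /andP[].
rewrite -(cvg_lim _ hr) //; apply: limr_le; first by apply/cvg_ex; exists l.
near=> h.
have h0 : 0 < h by [].
have h1 : h <= 1 by near: h; apply: nbhs_right_le.
have := cf y x h; rewrite h1 ltW // => /(_ isT) hc.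
rewrite -[_ *: _]/(_ * _) ler_pdivrMl //.
have -> : h *: (y - x) + x = h *: y + (1 - h) *: x.
  by rewrite scalerBr scalerBl scale1r -addrA (addrC (- _)).
lra.
Unshelve. all: by end_near. Qed.

(** The mean value theorem replaces integration: subtracting r^2 K from f on the segment, along with
    the linear term, leaves a function with nonpositive derivative. *)
Lemma smooth_descent (x v : 'cV[R]_N) (K : R) :
  (forall s, 0 < s < 1 ->
     dotv (grad f (x + s *: v) - grad f x) v <= 2 * s * K) ->
  f (x + v) <= f x + dotv (grad f x) v + K.
Proof.
move=> hK.
pose phi := fun r : R => f (x + r *: v) - (r * dotv (grad f x) v + r ^+ 2 * K).
pose dphi := fun r : R => dotv (grad f (x + r *: v)) v - (dotv (grad f x) v + 2 * r * K).
have dphiP (r : R) : is_derive r (1 : R) phi (dphi r).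
  apply: is_deriveB; first exact: is_derive_line.
  apply: is_derive_eq.
  by rewrite !scaler1 !scaler0 -[K *: _]/(K * _); ring.
have cphi : {within `[0, 1], continuous phi}.
  apply: continuous_subspaceT => r.
  by apply: differentiable_continuous; apply/derivable1_diffP; case: (dphiP r).
have [c] := MVT ltr01 (fun r _ => dphiP r) cphi; rewrite in_itv /= => c01.
rewrite /phi /dphi !scale1r scale0r !addr0 subr0 mulr1.
have := hK _ c01; rewrite dotvDl dotvNl; lra.
Qed.

End GradientBounds.

(** * Quadratic majorization along one block *)

Section BlockDescent.
Context {R : realType} {N m : nat} {f : 'cV[R]_N -> R}.
Context (hf : forall x, differentiable f x).

(** [smooth_descent] with K = l/2 |t|^2: duality and the Lipschitz bound at s t give l s |t|^2 = 2 s
    K. *)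
Lemma block_descent (V : 'M[R]_(N, m)) (B : 'M[R]_m) (l : R) x t :
  posdef B ->
  (forall t, dual_norm B (V^T *m grad f (x + V *m t) - V^T *m grad f x)
     <= l * blk_norm B t) ->
  f (x + V *m t) <= f x + dotv (V^T *m grad f x) t + l / 2 * blk_norm B t ^+ 2.
Proof.
move=> hB hL; rewrite dotv_mulmxl trmxK; apply: (smooth_descent hf) => s /andP[s0 s1].
rewrite scalemxAr dotvC dotv_mulmxl dotvC mulmxBr.
apply: le_trans (dotv_le_dual_norm hB _ _) _.
apply: le_trans (ler_wpM2r (blk_norm_ge0 _) (hL _)) _.
by rewrite (blk_normZ hB _ (ltW s0)) le_eqVlt; apply/orP; left; apply/eqP; field.
Qed.

End BlockDescent.

(** * Existence of minimizers by coercivity and compactness *)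

Section ConvexMinimization.
Context {R : realType} {m : nat}.
Local Open Scope classical_set_scope.

Lemma trmx_continuous p q : continuous (@trmx R p q).
Proof.
move=> M A [P hP sub]; exists (fun i j => P j i) => [i j|M' hM'].
  by have := hP j i; rewrite mxE.
by apply: sub => i j; rewrite mxE.
Qed.

Lemma cV_box_compact (b : 'I_m -> R) :
  compact [set t : 'cV[R]_m | forall j, `|t j 0| <= b j].
Proof.
have := @rV_compact R m (fun j => `[- b j, b j]) (fun j => @segment_compact R _ _).
move/(continuous_compact (continuous_subspaceT (@trmx_continuous 1 m))).
congr compact; apply/seteqP; split => [t [v hv <-] j|t ht].
  by have := hv j; rewrite /= in_itv /= mxE ler_norml.
by exists t^T; rewrite ?trmxK // => j; rewrite /= in_itv /= mxE -ler_norml.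
Qed.

Lemma mulmx_col_continuous (A : 'M[R]_m) j :
  continuous (fun t : 'cV[R]_m => (A *m t) j 0).
Proof.
under eq_fun do rewrite mxE.
apply: (continuous_big (@add_continuous R)) => l _ t.
by apply: (continuousM (@cst_continuous _ _ _ t) (@coord_continuous R m 1 l 0 t)).
Qed.

Lemma dotv_continuous (a : 'cV[R]_m) : continuous (dotv a).
Proof.
have -> : dotv a = (fun t => \sum_j a j 0 * t j 0) by apply/funext => t; rewrite dotvE.
apply: (continuous_big (@add_continuous R)) => l _ t.
by apply: (continuousM (@cst_continuous _ _ _ t) (@coord_continuous R m 1 l 0 t)).
Qed.

Lemma posdef_form_continuous (B : 'M[R]_m) (c : 'cV[R]_m) :
  posdef B -> continuous (fun t : 'cV[R]_m => blk_norm B (t - c) ^+ 2).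
Proof.
move=> hB.
have -> : (fun t : 'cV[R]_m => blk_norm B (t - c) ^+ 2) = (fun t =>
    \sum_j (B *m t) j 0 * t j 0 - 2 * dotv (B *m c) t + blk_norm B c ^+ 2).
  apply/funext => t.
  by rewrite -dotvE -blk_norm_sqr // (blk_norm_sqrB hB).
have cs : continuous (fun t : 'cV[R]_m => \sum_j (B *m t) j 0 * t j 0).
  apply: (continuous_big (@add_continuous R)) => j _ t.
  by apply: (continuousM (@mulmx_col_continuous B j t) (@coord_continuous R m 1 j 0 t)).
have cd : continuous (fun t : 'cV[R]_m => 2 * dotv (B *m c) t).
  move=> t; exact: (continuousM (@cst_continuous _ _ _ t) (@dotv_continuous _ t)).
move=> t; exact: (continuousD (continuousB (cs t) (cd t)) (@cst_continuous _ _ _ t)).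
Qed.

(* The variable v = q t + r turns the epigraph of g into that of q + g; by
   coercivity its part below a level is compact, and v is minimized there. *)
Lemma coercive_min_exists (B : 'M[R]_m) (q : 'cV[R]_m -> R) (g : 'cV[R]_m -> \bar R)
  (al d : R) (w : 'cV[R]_m) :
  posdef B -> continuous q -> proper_fun g -> closed_fun g -> 0 < al ->
  (forall t, (al * blk_norm B t ^+ 2 + dotv w t + d)%:E <= (q t)%:E + g t)%E ->
  exists t, forall s, ((q t)%:E + g t <= (q s)%:E + g s)%E.
Proof.
move=> hB cq [gNy [t0 gt0]] cg al0 hlow.
pose c0 := q t0 + fine (g t0).
pose be := dual_norm B (- w).
(* Beyond radius [M], r >= 1 and al r - be > |c0 - d|, hence al r^2 - be r + d > c0. *)
pose M := 1 + (be + `|c0 - d|) / al.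
have be0 : 0 <= be by apply: sqrtr_ge0.
have low t : al * blk_norm B t ^+ 2 - be * blk_norm B t + d <=
             al * blk_norm B t ^+ 2 + dotv w t + d.
  have := dotv_le_dual_norm hB (- w) t; rewrite dotvNl -/be; lra.
have bnd t : al * blk_norm B t ^+ 2 + dotv w t + d <= c0 -> blk_norm B t <= M.
  move=> h; rewrite leNgt; apply/negP => hM.
  have r1 : 1 <= blk_norm B t.
    apply: le_trans (ltW hM); rewrite lerDl divr_ge0 ?(ltW al0) // addr_ge0 //.
  have : be + `|c0 - d| < al * blk_norm B t.
    by rewrite -ltr_pdivrMl // mulrC (lt_trans _ hM) // /M ltrDr.
  have := low t; have := ler_norm (c0 - d); have := normr_ge0 (c0 - d).
  by move: h r1 be0 al0; rewrite expr2; nra.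
(* Written this way, the first condition is the preimage of the epigraph of [g] under the continuous
   map (t, v) -> (t, v - q t), hence closed. *)
pose K := [set p : 'cV[R]_m * R | ((g p.1 <= (p.2 - q p.1)%:E)%E /\ p.2 <= c0)].
have csnd : continuous (@snd 'cV[R]_m R) by move=> p; exact: cvg_snd.
have cK : compact K.
  (* Coordinates are pairings with basis vectors, so the norm bound [M] confines each of them; the
     height lies between d - be M and c0. *)
  have cbox := compact_setX
    (@cV_box_compact (fun j => dual_norm B (delta_mx j 0) * M))
    (@segment_compact R (d - be * M) c0).
  apply: subclosed_compact cbox _.
    apply: closedI.
      have c1 : continuous (@fst 'cV[R]_m R) by move=> p; exact: cvg_fst.
      have c2 : continuous (fun p : 'cV[R]_m * R => p.2 - q p.1).
        move=> p; have cqp := continuous_comp (c1 p) (cq p.1).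
        exact: (continuousB (csnd p) cqp).
      have cphi : continuous (fun p : 'cV[R]_m * R => (p.1, p.2 - q p.1)).
        by move=> p; exact: (cvg_pair (c1 p) (c2 p)).
      exact: ((continuous_closedP _).1 cphi _ cg).
    exact: ((continuous_closedP _).1 csnd _ (@closed_le R c0)).
  move=> [t v] [/= gv vc].
  have lv : al * blk_norm B t ^+ 2 + dotv w t + d <= v.
    have := hlow t; move: gv; case: (g t) (gNy t) => [r| |] //= _.
    by rewrite -EFinD !lee_fin; lra.
  have tM := bnd t (le_trans lv vc).
  have t0' := blk_norm_ge0 (B := B) t.
  split => /=; last first.
    rewrite in_itv /= vc andbT; apply: le_trans lv.
    apply: le_trans (low t).
    have : be * blk_norm B t <= be * M by rewrite ler_wpM2l.
    have : 0 <= al * blk_norm B t ^+ 2 by rewrite mulr_ge0 ?sqr_ge0 // ltW.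
    lra.
  move=> j; rewrite ler_norml; apply/andP; split.
    rewrite lerNl -dotv_delta -dotvNr.
    apply: le_trans (dotv_le_dual_norm hB _ _) _; rewrite ler_wpM2l ?sqrtr_ge0 //.
    have -> // : blk_norm B (- t) = blk_norm B t.
    by rewrite /blk_norm mulmxN dotvNl dotvNr opprK.
  rewrite -dotv_delta; apply: le_trans (dotv_le_dual_norm hB _ _) _.
  by rewrite ler_wpM2l ?sqrtr_ge0.
have K0 : K !=set0.
  exists (t0, c0); split => //=; rewrite /c0 addrAC subrr add0r fineK //.
(* The height v is continuous on [K], whereas q + g need not be. *)
have [[t v]] := compact_EVT_min K0 cK (continuous_subspaceT csnd).
rewrite inE => -[/= gv vc] hmin; exists t => s.
have tv : ((q t)%:E + g t <= v%:E)%E.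
  move: gv; case: (g t) (gNy t) => [r| |] //= _.
  by rewrite -EFinD !lee_fin; lra.
apply: le_trans tv _.
case gs : (g s) (gNy s) => [r| |] //= _; last by rewrite addey // leey.
rewrite -EFinD lee_fin.
have [h|/ltW h] := lerP (q s + r) c0; last exact: le_trans vc h.
have := hmin (s, q s + r); rewrite inE; apply; split => //=.
by rewrite gs lee_fin; lra.
Qed.

End ConvexMinimization.

(** * Progress of one block step on the regularized objective *)

Section RegularizedStep.
Context {R : realType} {N n : nat} {Ns : 'I_n -> nat}.
Context (U : forall i : 'I_n, 'M[R]_(N, Ns i)) (B : forall i : 'I_n, 'M[R]_(Ns i)).
Context (L : 'I_n -> R) (f : 'cV[R]_N -> R) (Psi : forall i : 'I_n, 'cV[R]_(Ns i) -> \bar R).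
Context (xstar x0 : 'cV[R]_N) (mu : R).
Arguments Psi : clear implicits.
Local Notation blk i x := ((U i)^T *m x).

Definition in_dom (x : 'cV[R]_N) : Prop := forall i, Psi i (blk i x) \is a fin_num.

Definition reg_part (i : 'I_n) (t : 'cV[R]_(Ns i)) : \bar R :=
  (Psi i t + (mu / 2 * L i * blk_norm (B i) (t - blk i x0) ^+ 2)%:E)%E.

(** Real-valued form of [reg_part], faithful only on the domain because [fine] sends infinite values
    to 0. *)
Definition reg_part_fin (i : 'I_n) (t : 'cV[R]_(Ns i)) : R :=
  fine (Psi i t) + mu / 2 * L i * blk_norm (B i) (t - blk i x0) ^+ 2.

Definition reg_obj (x : 'cV[R]_N) : R := f x + \sum_i reg_part_fin (blk i x).

Local Notation T x i := (ucdc_T U B L f (@reg_part) x i).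

Context (hU : col_perm_blocks U) (hB : forall i, posdef (B i)) (hL : forall i, 0 < L i).
Context (cf : convex_fun f) (df : forall x, differentiable f x).
Context (hlip : forall x i (t : 'cV[R]_(Ns i)),
  dual_norm (B i) ((U i)^T *m grad f (x + U i *m t) - (U i)^T *m grad f x)
    <= L i * blk_norm (B i) t).
Context (hPsi : forall i, proper_fun (Psi i) /\ ext_convex (Psi i) /\ closed_fun (Psi i)).
Context (hmin : forall y, (Fcomp U f Psi xstar <= Fcomp U f Psi y)%E).

Lemma Lnorm2_ge0 x : 0 <= Lnorm2 U B L x.
Proof. by apply: sumr_ge0 => i _; rewrite mulr_ge0 ?sqr_ge0 // ltW. Qed.

Lemma reg_objE x :
  reg_obj x = f x + \sum_i fine (Psi i (blk i x)) + mu / 2 * Lnorm2 U B L (x0 - x).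
Proof.
rewrite /reg_obj big_split /= addrA /Lnorm2 mulr_sumr; congr (_ + _).
apply: eq_bigr => i _; rewrite mulmxBr.
rewrite -(opprB ((U i)^T *m x) ((U i)^T *m x0)) -(scaleN1r (_ - _)).
by rewrite (blk_norm_sqrZ (hB i)) sqrrN expr1n mul1r mulrA.
Qed.

Lemma Fcomp_in_dom x : Fcomp U f Psi x \is a fin_num -> in_dom x.
Proof.
rewrite /Fcomp fin_numD => /andP[_] /sum_fin_numP h i.
by apply: h; rewrite ?mem_index_enum.
Qed.

Lemma in_dom_FcompE x :
  in_dom x -> Fcomp U f Psi x = (f x + \sum_i fine (Psi i (blk i x)))%:E.
Proof. by move=> hx; rewrite /Fcomp /Psi_sum -EFin_sum_fine. Qed.

Lemma Psi_notNy i t : Psi i t != -oo%E.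
Proof. by have [[h _] _] := hPsi i. Qed.

(** Comparison with a point of the domain excludes the value +oo at [xstar]; properness excludes
    -oo. *)
Lemma in_dom_minimizer x : in_dom x -> in_dom xstar.
Proof.
move=> hx; apply: Fcomp_in_dom; rewrite fin_numElt; apply/andP; split; last first.
  by apply: le_lt_trans (hmin x) _; rewrite in_dom_FcompE // ltry.
have sNy : Psi_sum U Psi xstar != -oo%E.
  by rewrite esum_eqNy; apply/existsPn => i; rewrite negb_and Psi_notNy orbT.
by rewrite ltNye /Fcomp; case: (Psi_sum U Psi xstar) sNy.
Qed.

Lemma in_dom_block_update i x t :
  in_dom x -> Psi i (blk i x + t) \is a fin_num -> in_dom (x + U i *m t).
Proof.
move=> hx ht j; have [<-|ij] := eqVneq i j.
  by rewrite block_proj_step_same.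
by rewrite block_proj_step.
Qed.

(* Minimality of xstar and the descent lemma bound Psi_i below by a quadratic,
   so no affine minorant from Hahn-Banach is needed for coercivity. *)
Lemma Psi_quadratic_lower i (z : 'cV[R]_(Ns i)) :
  in_dom xstar ->
  ((fine (Psi i (blk i xstar)) - dotv (blk i (grad f xstar)) (z - blk i xstar)
    - L i / 2 * blk_norm (B i) (z - blk i xstar) ^+ 2)%:E <= Psi i z)%E.
Proof.
move=> hs; case hz : (Psi i z) (Psi_notNy z) => [r| |] //= _; last by rewrite leey.
set t := z - _.
have zE : blk i xstar + t = z by rewrite addrC subrK.
have hy : in_dom (xstar + U i *m t) by apply: in_dom_block_update; rewrite // zE hz.
have := hmin (xstar + U i *m t); rewrite !in_dom_FcompE // !lee_fin.
rewrite (block_sum_step hU (fun j t => fine (Psi j t))) zE hz /=.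
have := block_descent df t (hB i) (hlip xstar (i := i)).
lra.
Qed.

(** [argmin] defaults to 0 when no minimizer exists, so attainment must be proved first, by
    coercivity. *)
Lemma ucdc_T_is_min x i (s : 'cV[R]_(Ns i)) : 0 < mu -> in_dom xstar ->
  ((dotv (blk i (grad f x)) (T x i) + L i / 2 * blk_norm (B i) (T x i) ^+ 2)%:E
     + reg_part (blk i x + T x i)%R
   <= (dotv (blk i (grad f x)) s + L i / 2 * blk_norm (B i) s ^+ 2)%:E
     + reg_part (blk i x + s)%R)%E.
Proof.
move=> mu0 hs; set g := blk i (grad f x); set gs := blk i (grad f xstar).
pose h t := ((dotv g t + L i / 2 * blk_norm (B i) t ^+ 2)%:E
  + reg_part (blk i x + t)%R)%E.
suff hex : exists t, forall s, (h t <= h s)%E.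
  exact: (xgetPex 0 (P := fun t => forall s, (h t <= h s)%E)).
(* The variable z = x^(i) + t leaves [Psi] unshifted and puts all shifts into the continuous part
   [q]. *)
pose q (z : 'cV[R]_(Ns i)) := dotv g (z - blk i x) + L i / 2 * blk_norm (B i) (z - blk i x) ^+ 2
  + mu / 2 * L i * blk_norm (B i) (z - blk i x0) ^+ 2.
have hE z : h (z - blk i x) = ((q z)%:E + Psi i z)%E.
  rewrite /h /reg_part [(_ + (z - _))%R]addrC subrK addeCA addeC; congr (_ + _)%E.
have cq : continuous q.
  have cd : continuous (fun z : 'cV[R]_(Ns i) => dotv g (z - blk i x)).
    under eq_fun do rewrite dotvDr.
    by move=> z; exact: (continuousD (@dotv_continuous _ _ g z) (@cst_continuous _ _ _ z)).
  have cn (c : R) y : continuous (fun z : 'cV[R]_(Ns i) => c * blk_norm (B i) (z - y) ^+ 2).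
    move=> z; exact: (continuousM (@cst_continuous _ _ c z)
                        (@posdef_form_continuous _ _ (B i) y (hB i) z)).
  by move=> z; exact: (continuousD (continuousD (cd z) (cn _ _ z)) (cn _ _ z)).
have [pP [_ cP]] := hPsi i.
(* In the lower bound for q + Psi_i the model curvature L_i/2 cancels that of [Psi_quadratic_lower];
   mu L_i/2 survives, and [w] and [d] collect the linear and constant terms. *)
pose w := g - L i *: (B i *m blk i x) - (mu * L i) *: (B i *m blk i x0)
  - gs + L i *: (B i *m blk i xstar).
pose d := - dotv g (blk i x) + L i / 2 * blk_norm (B i) (blk i x) ^+ 2
  + mu / 2 * L i * blk_norm (B i) (blk i x0) ^+ 2 + fine (Psi i (blk i xstar))
  + dotv gs (blk i xstar) - L i / 2 * blk_norm (B i) (blk i xstar) ^+ 2.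
have al0 : 0 < mu / 2 * L i by apply: mulr_gt0 (hL i); apply: divr_gt0.
have [z|z hz] := @coercive_min_exists _ _ (B i) q (Psi i) _ d w (hB i) cq pP cP al0.
  have := Psi_quadratic_lower z hs.
  case: (Psi i z) (Psi_notNy z) => [r| |] //= _; last by rewrite addey ?leey.
  rewrite -EFinD !lee_fin => hr.
  have nB := blk_norm_sqrB (hB i) z.
  have dB (a y : 'cV[R]_(Ns i)) : dotv a (z - y) = dotv a z - dotv a y.
    by rewrite dotvDr dotvNr.
  have dw (a b c e k : 'cV[R]_(Ns i)) (l p : R) :
      dotv (a - l *: b - p *: c - e + l *: k) z =
      dotv a z - l * dotv b z - p * dotv c z - dotv e z + l * dotv k z.
    by rewrite !(dotvDl, dotvNl, dotvZl).
  move: hr; rewrite -/gs /w dw /q /d (dB g) (dB gs) (nB (blk i x)) (nB (blk i x0)).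
  rewrite (nB (blk i xstar)); lra.
exists (z - blk i x) => r; have := hz (blk i x + r); rewrite -!hE.
by rewrite (addrC _ r) addrK.
Qed.

(** The model is finite at the zero step, hence at its minimizer. *)
Lemma ucdc_T_in_dom x i : 0 < mu -> in_dom xstar -> in_dom x ->
  Psi i (blk i x + T x i) \is a fin_num.
Proof.
move=> mu0 hs hx; have := ucdc_T_is_min x (0 : 'cV[R]_(Ns i)) mu0 hs.
rewrite addr0 /reg_part -(fineK (hx i)).
by case: (Psi i (blk i x + T x i)) (Psi_notNy (blk i x + T x i)).
Qed.

Lemma reg_obj_block_step x i (s : 'cV[R]_(Ns i)) :
  0 < mu -> in_dom xstar -> in_dom x -> Psi i (blk i x + s) \is a fin_num ->
  reg_obj (x + U i *m T x i) - reg_obj x <=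
    dotv (blk i (grad f x)) s + L i / 2 * blk_norm (B i) s ^+ 2
    + (reg_part_fin (blk i x + s) - reg_part_fin (blk i x)).
Proof.
move=> mu0 hs hx hsf.
have := ucdc_T_is_min x s mu0 hs; rewrite /reg_part.
rewrite -(fineK hsf) -(fineK (ucdc_T_in_dom i mu0 hs hx)) -!EFinD lee_fin.
have := block_descent df (T x i) (hB i) (hlip x (i := i)).
rewrite /reg_obj (block_sum_step hU (@reg_part_fin)).
rewrite /reg_part_fin; lra.
Qed.

(* a = mu (1 - a) makes the strong convexity gain of the regularizer cancel
   the quadratic term of the block models exactly. *)
Lemma reg_obj_sum_step x y a : 0 < mu -> in_dom xstar -> in_dom x -> in_dom y ->
  0 < a < 1 -> a = mu * (1 - a) ->
  \sum_i (reg_obj (x + U i *m T x i) - reg_obj x) <= a * (reg_obj y - reg_obj x).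
Proof.
move=> mu0 hs hx hy a01 aE.
have hi i : reg_obj (x + U i *m T x i) - reg_obj x <=
    a * (dotv (blk i (grad f x)) (blk i (y - x))
         + (reg_part_fin (blk i y) - reg_part_fin (blk i x))).
  set d := blk i (y - x).
  have dE : d = blk i y - blk i x by rewrite /d mulmxBr.
  have xd : blk i x + a *: d = a *: blk i y + (1 - a) *: blk i x.
    by rewrite dE scalerBr scalerBl scale1r addrCA (addrC (blk i x)).
  (* Convexity at the trial point also shows that [Psi] is finite there. *)
  have cP : (Psi i (blk i x + a *: d) <=
      (a * fine (Psi i (blk i y)) + (1 - a) * fine (Psi i (blk i x)))%:E)%E.
    have [_ [cP _]] := hPsi i.
    by rewrite xd EFinD !EFinM !fineK //; apply: cP.
  have fP : Psi i (blk i x + a *: d) \is a fin_num.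
    move: cP; case: (Psi i _) (Psi_notNy (blk i x + a *: d)) => //.
  apply: le_trans (reg_obj_block_step mu0 hs hx fP) _.
  move: cP; rewrite -(fineK fP) lee_fin => cP.
  have := blk_norm_sqr_conv (hB i) a (blk i x - blk i x0) (blk i y - blk i x0).
  have -> : (1 - a) *: (blk i x - blk i x0) + a *: (blk i y - blk i x0) =
      blk i x + a *: d - blk i x0.
    rewrite xd !scalerBr addrACA -opprD -scalerDl subrK scale1r.
    by rewrite [X in X - _]addrC.
  have -> : blk i y - blk i x0 - (blk i x - blk i x0) = d.
    by rewrite dE opprB addrA subrK.
  rewrite /reg_part_fin (dotvZr a _ d) (blk_norm_sqrZ (hB i) a d) => ->.
  have -> : L i / 2 * (a ^+ 2 * blk_norm (B i) d ^+ 2) =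
      mu / 2 * L i * (a * (1 - a) * blk_norm (B i) d ^+ 2).
    by rewrite expr2 {2}aE; field.
  lra.
(* Summed over blocks, the pairings form the full inner product of the gradient with y - x, at most
   f y - f x. *)
apply: le_trans (ler_sum _ (fun i _ => hi i)) _.
rewrite -mulr_sumr big_split /= -dotv_block_sum // sumrB ler_pM2l; last by case/andP: a01.
have := convex_grad_le df x y cf.
rewrite /reg_obj; lra.
Qed.

End RegularizedStep.

(** * Averages over random block sequences, Markov's inequality and the geometric rate *)

Section RandomWalkAverage.
Context {R : realType} {n : nat} {X : Type}.

Lemma sum_tuple_cons (k : nat) (G : seq 'I_n -> R) :
  \sum_(s : k.+1.-tuple 'I_n) G s = \sum_i \sum_(s : k.-tuple 'I_n) G (i :: s).
Proof.
rewrite pair_big_dep /=.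
rewrite (reindex (fun p : 'I_n * k.-tuple 'I_n => [tuple of p.1 :: p.2])) //=.
exists (fun s : k.+1.-tuple 'I_n => (thead s, [tuple of behead s])) => [[i s] _|s _] /=.
  by rewrite theadE; congr pair; apply: val_inj.
by rewrite -tuple_eta.
Qed.

(** An expectation bound without normalization: the sum runs over all n^k sequences, so [c] is n
    times the contraction factor. The induction splits off the first choice, which [foldl] applies
    first. *)
Lemma sum_foldl_contract (step : X -> 'I_n -> X) (G : X -> R) (D : X -> Prop) (c : R) :
  0 <= c -> (forall x i, D x -> D (step x i)) ->
  (forall x, D x -> \sum_i G (step x i) <= c * G x) ->
  forall k x, D x -> \sum_(s : k.-tuple 'I_n) G (foldl step x s) <= c ^+ k * G x.
Proof.
move=> c0 hD hc; elim=> [|k IH] x hx.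
  rewrite (big_pred1 [tuple]) /= ?expr0 ?mul1r // => s.
  by apply/esym/eqP; rewrite tuple0.
rewrite (sum_tuple_cons k (fun s => G (foldl step x s))) /=.
apply: (@le_trans _ _ (\sum_i c ^+ k * G (step x i))).
  by apply: ler_sum => i _; apply: IH; apply: hD.
by rewrite -mulr_sumr exprSr -mulrA ler_wpM2l ?exprn_ge0 ?hc.
Qed.

(** Markov's inequality by counting: each element outside [P] contributes more than [e] to the
    sum. *)
Lemma card_markov (I : finType) (G : I -> R) (e c : R) (P : pred I) :
  0 < e -> (forall i, 0 <= G i) -> (forall i, G i <= e -> P i) ->
  \sum_i G i <= c * e * #|I|%:R -> (1 - c) * #|I|%:R <= #|P|%:R.
Proof.
move=> e0 G0 hP hG.
have : #|[predC P]|%:R * e <= \sum_i G i.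
  rewrite mulr_natl -sumr_const (bigID (mem [predC P]) xpredT) /=.
  rewrite -[leLHS]addr0 lerD ?sumr_ge0 //; apply: ler_sum => i.
  by rewrite !inE => hi; apply/ltW; rewrite ltNge; apply: contra hi => /hP.
move/le_trans => /(_ _ hG); rewrite -mulrA (mulrC e) mulrA ler_pM2r // => h.
rewrite mulrBl mul1r -[X in X%:R - _](cardC P) natrD; lra.
Qed.

(** Uses (1 - a/q)^k <= exp(- a k / q) <= r/d; the case d = 0 is separate because [ln] inverts
    [expR] only at positive arguments. *)
Lemma exp_rate_bound (a q d r : R) k : 0 <= a <= q -> 0 < q -> 0 <= d -> 0 < r ->
  ln (d / r) <= a * k%:R / q -> (q - a) ^+ k * d <= q ^+ k * r.
Proof.
move=> /andP[a0 aq] q0 d0 r0 hk.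
have [->|dn0] := eqVneq d 0; first by rewrite mulr0 mulr_ge0 ?exprn_ge0 // ltW.
have dp : 0 < d by rewrite lt_def dn0.
have dr : d / r <= expR (a * k%:R / q).
  by rewrite -[leLHS]lnK ?posrE ?divr_gt0 // ler_expR.
have -> : q - a = q * (1 - a / q) by field; lra.
rewrite exprMn -mulrA ler_wpM2l ?exprn_ge0 ?(ltW q0) //.
have : (1 - a / q) ^+ k <= expR (- (a * k%:R / q)).
  have -> : - (a * k%:R / q) = k%:R * - (a / q) by ring.
  rewrite expRM_natl lerXn2r ?nnegrE ?expR_ge0 ?expR_ge1Dx //.
  by rewrite subr_ge0 ler_pdivrMr ?mul1r.
move=> h; apply: le_trans (ler_wpM2r d0 h) _.
by rewrite expRN ler_pdivrMl ?expR_gt0 // -ler_pdivrMr.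
Qed.

End RandomWalkAverage.

(** * From expected contraction to the probability bound *)

Theorem theorem9 (R : realType) (N n : nat) (Ns : 'I_n -> nat)
  (U : forall i : 'I_n, 'M[R]_(N, Ns i)) (B : forall i : 'I_n, 'M[R]_(Ns i))
  (L : 'I_n -> R) (f : 'cV[R]_N -> R)
  (Psi : forall i : 'I_n, 'cV[R]_(Ns i) -> \bar R)
  (xstar x0 : 'cV[R]_N) (eps rho : R) (k : nat) :
  col_perm_blocks U ->
  (forall i, posdef (B i)) ->
  (forall i, 0 < L i) ->
  convex_fun f ->
  (forall x, differentiable f x) ->
  (forall x i (t : 'cV[R]_(Ns i)),
      dual_norm (B i) ((U i)^T *m grad f (x + U i *m t) - (U i)^T *m grad f x)
        <= L i * blk_norm (B i) t) ->
  (forall i, proper_fun (Psi i) /\ ext_convex (Psi i) /\ closed_fun (Psi i)) ->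
  (forall y, (Fcomp U f Psi xstar <= Fcomp U f Psi y)%E) ->
  Fcomp U f Psi x0 \is a fin_num ->
  0 < eps -> eps <= 2 * Lnorm2 U B L (x0 - xstar) ->
  0 < rho < 1 ->
  4 * n%:R * Lnorm2 U B L (x0 - xstar) / eps
    * ln (2 * (fine (Fcomp U f Psi x0) - fine (Fcomp U f Psi xstar)) / (rho * eps))
    <= k%:R ->
  let mu := eps / Lnorm2 U B L (x0 - xstar) in
  let Phi := fun (i : 'I_n) (t : 'cV[R]_(Ns i)) =>
    (Psi i t + (mu / 2 * L i * blk_norm (B i) (t - (U i)^T *m x0) ^+ 2)%:E)%E in
  1 - rho <= ucdc_prob U B L f Phi x0 k
               (fun x => (Fcomp U f Psi x <= Fcomp U f Psi xstar + eps%:E)%E).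
Proof.
move=> hU hB hL cf df hlip hPsi hmin hF0 e0 eL /andP[r0 r1].
set D := Lnorm2 U B L (x0 - xstar) in eL *; move=> hk.
pose mu := eps / D; pose Phi := @reg_part R N n Ns U B L Psi x0 mu.
change (is_true (1 - rho <= ucdc_prob U B L f Phi x0 k
  (fun x => (Fcomp U f Psi x <= Fcomp U f Psi xstar + eps%:E)%E))).
have D0 : 0 < D by lra.
have mu0 : 0 < mu by rewrite divr_gt0.
have mu2 : mu <= 2 by rewrite ler_pdivrMr.
(* With no blocks [D] would be an empty sum, against D > 0. *)
have n0 : 0 < n%:R :> R.
  rewrite ltr0n lt0n; apply/negP => /eqP nE; move: D0; rewrite /D /Lnorm2 big1 ?ltxx //.
  by move=> i; have := ltn_ord i; rewrite {2}nE.
have dx0 : in_dom U Psi x0 by apply: Fcomp_in_dom hF0.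
have ds : in_dom U Psi xstar by apply: in_dom_minimizer dx0.
pose F x := f x + \sum_i fine (Psi i ((U i)^T *m x)).
have FE x : in_dom U Psi x -> Fcomp U f Psi x = (F x)%:E by exact: in_dom_FcompE.
have Fmin y : in_dom U Psi y -> F xstar <= F y.
  by move=> hy; have := hmin y; rewrite !FE.
pose H := reg_obj U B L f Psi x0 mu.
have HE x : H x = F x + mu / 2 * Lnorm2 U B L (x0 - x) by apply: reg_objE.
have HF x : F x <= H x by rewrite HE lerDl mulr_ge0 ?Lnorm2_ge0 // divr_ge0 // ltW.
have Hx0 : H x0 = F x0.
  rewrite HE subrr /Lnorm2 big1 ?mulr0 ?addr0 // => i _.
  by rewrite mulmx0 (blk_norm_sqr (hB i)) dotv0 mulr0.
have Hxs : H xstar = F xstar + eps / 2.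
  by rewrite HE -/D /mu; congr (_ + _); field; rewrite gt_eqF.
(* The regularizer is nonnegative, so F^* bounds [E] below and [inf E] is a genuine infimum. *)
pose E := [set H y | y in in_dom U Psi]%classic.
have lbE : lbound E (F xstar) by move=> _ [y hy <-]; apply: le_trans (HF y); apply: Fmin.
pose m := inf E.
have mE y : in_dom U Psi y -> m <= H y.
  by move=> hy; apply: ge_inf; [exists (F xstar)|exists y].
have Fm : F xstar <= m by apply: lb_le_inf => //; exists (H xstar), xstar.
pose step x i := x + U i *m ucdc_T U B L f Phi x i.
have dstep x i : in_dom U Psi x -> in_dom U Psi (step x i).
  move=> hx; apply: in_dom_block_update => //; exact: ucdc_T_in_dom.
have diter s x : in_dom U Psi x -> in_dom U Psi (foldl step x s).
  by elim: s x => //= i s IH x hx; apply/IH/dstep.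
(* The root of a = mu (1 - a), as [reg_obj_sum_step] requires. *)
pose a := mu / (1 + mu).
have a0 : 0 < a by rewrite divr_gt0 //; lra.
have a1 : a < 1 by rewrite ltr_pdivrMr; lra.
have aE : a = mu * (1 - a) by rewrite /a; field; lra.
have a4 : mu / 4 <= a by rewrite ler_pdivlMr; nra.
have n1 : 1 <= n%:R :> R by move: n0; rewrite ltr0n ler1n.
have contract x : in_dom U Psi x ->
    \sum_i (H (step x i) - m) <= (n%:R - a) * (H x - m).
  move=> hx.
  (* The one-step bound holds for every y in the domain; solved for H y, it makes the left side a
     lower bound of [E]. *)
  have : (\sum_i (H (step x i) - H x)) / a + H x <= m.
    apply: lb_le_inf; first by exists (H xstar), xstar.
    move=> _ [y hy <-]; rewrite -lerBrDr ler_pdivrMr // mulrC.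
    by apply: reg_obj_sum_step => //; rewrite a0.
  rewrite -lerBrDr ler_pdivrMr // => h.
  have -> : \sum_i (H (step x i) - m) = \sum_i (H (step x i) - H x) + n%:R * (H x - m).
    have -> : n%:R * (H x - m) = \sum_(i < n) (H x - m).
      by rewrite sumr_const card_ord mulr_natl.
    rewrite -big_split /=.
    by apply: eq_bigr => i _; rewrite addrA subrK.
  lra.
have na : 0 <= n%:R - a by lra.
have hsum := sum_foldl_contract na dstep contract k dx0.
rewrite /ucdc_prob ler_pdivlMr; last by rewrite ltr0n card_tuple card_ord expn_gt0 -(ltr0n R) n0.
pose Q (s : k.-tuple 'I_n) :=
  (Fcomp U f Psi (foldl step x0 s) <= Fcomp U f Psi xstar + eps%:E)%E.
(* [ucdc_prob] counts a classical set and Markov's bound a boolean predicate; inclusion compares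
   their cardinalities. *)
suff cQ : (1 - rho) * #|{: k.-tuple 'I_n}|%:R <= #|Q|%:R.
  apply: le_trans cQ _; rewrite ler_nat; apply/subset_leq_card/fintype.subsetP => s hs.
  by apply: mem_set; exact: hs.
apply: (@card_markov _ _ (fun s : k.-tuple 'I_n => H (foldl step x0 s) - m) (eps / 2)).
- by rewrite divr_gt0.
- by move=> s; rewrite subr_ge0 mE //; apply: diter.
- move=> s hs; rewrite /Q !FE ?lee_fin //; last exact: diter.
  have := HF (foldl step x0 s); have := mE _ ds; rewrite Hxs; lra.
apply: le_trans hsum _.
rewrite card_tuple card_ord natrX [leRHS]mulrC mulrA.
apply: (@le_trans _ _ ((n%:R - a) ^+ k * (F x0 - F xstar))).
  (* The initial gap H x0 - m is at most F x0 - F^*, since the regularizer vanishes at [x0] and F^*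
     <= m. *)
  by rewrite ler_wpM2l ?exprn_ge0 // Hx0; lra.
rewrite -mulrA; apply: exp_rate_bound => //.
- by rewrite ltW //=; lra.
- by rewrite subr_ge0 Fmin.
- by rewrite mulr_gt0 ?divr_gt0.
have -> : (F x0 - F xstar) / (rho * (eps / 2)) = 2 * (F x0 - F xstar) / (rho * eps).
  by field; rewrite !gt_eqF.
move: hk; rewrite !FE //= => hk; rewrite ler_pdivlMr //.
(* With [a] weakened to mu/4 and mu = eps/D, the factor 4 n D / eps in the bound on [k] becomes
   exactly n. *)
apply: le_trans (ler_wpM2r (ler0n R k) a4).
apply: le_trans (ler_wpM2l _ hk); last by rewrite divr_ge0 // ltW.
rewrite le_eqVlt; apply/orP; left; apply/eqP; rewrite /mu; field.
by rewrite !gt_eqF.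
Qed.
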